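(* Let $G$ be a finite nilpotent group. Then $G$ is exponent-complete, that is, $\omega(G)=\{d\in\mathbb{N}: d\mid\exp G\}$, and hence $\eta(G)=\tau(\exp G)$.
   Context: For a finite group $G$, $\omega(G)$ denotes the set of orders of elements of $G$ and $\eta(G)=|\omega(G)|$. The exponent $\exp G$ is the least common multiple of the orders of the elements of $G$, and $\tau(m)$ is the number of positive divisors of $m$. A finite group $G$ is called exponent-complete if every positive divisor of $\exp G$ is the order of an element of $G$, i.e. $\omega(G)=\{d: d\mid\exp G\}$. *)

(* Defs.v *)
From mathcomp Require Import all_boot all_fingroup all_solvable.

Set Implicit Arguments.
Unset Strict Implicit.
Unset Printing Implicit Defensive.

Local Open Scope group_scope.

(* A finite set of naturals, represented as a duplicate-free sequence: the   *)
(* order of its entries is irrelevant, and its size is its cardinality.      *)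
Definition omega (gT : finGroupType) (A : {set gT}) : seq nat :=
  undup [seq #[x] | x in A].

Definition eta (gT : finGroupType) (A : {set gT}) : nat := size (omega A).

(* [divisors m] is the duplicate-free list of positive divisors for m > 0,   *)
(* and is empty for m = 0.                                                   *)
Definition tau (m : nat) : nat := size (divisors m).

(* Since [exponent G] is positive, its divisors in nat are positive.         *)
Definition exponent_complete (gT : finGroupType) (G : {group gT}) : Prop :=
  omega G =i [pred d : nat | d %| exponent G].

(* Main.v *)
Require Import Defs.
From mathcomp Require Import all_boot all_fingroup all_solvable.

(** Every element order divides the exponent, so only the converse inclusion
    uses nilpotency.  A finite nilpotent group is the direct product of its
    Sylow subgroups; each Sylow p-subgroup has an element whose order is the
    p-part of the exponent, and since these elements commute and have coprime
    orders, their product x has order exactly the exponent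
    ([exponent_witness]).  The cyclic group generated by x then has an element
    of every order dividing the exponent. *)

Lemma mem_omega (gT : finGroupType) (A : {set gT}) (d : nat) :
  reflect (exists2 x, x \in A & d = #[x]%g) (d \in omega A).
Proof. by rewrite /omega mem_undup; apply: imageP. Qed.

Lemma dvdn_order_omega (gT : finGroupType) (G : {group gT}) (x : gT) (d : nat) :
  x \in G -> d %| #[x]%g -> d \in omega G.
Proof.
move=> Gx d_x; apply/mem_omega; exists (x ^+ (#[x]%g %/ d))%g.
  exact: groupX.
by rewrite orderXdiv ?dvdn_div // divnA // mulKn ?order_gt0.
Qed.

Lemma nilpotent_exponent_complete (gT : finGroupType) (G : {group gT}) :
  nilpotent G -> exponent_complete G.
Proof.
case/exponent_witness=> x Gx exp_x d; rewrite inE.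
apply/idP/idP=> [/mem_omega[y Gy ->] | ]; first exact: dvdn_exponent.
by rewrite exp_x; apply: dvdn_order_omega.
Qed.

Lemma exponent_complete_eta (gT : finGroupType) (G : {group gT}) :
  exponent_complete G -> eta G = tau (exponent G).
Proof.
move=> complG; apply/perm_size/uniq_perm; first exact: undup_uniq.
  exact: divisors_uniq.
by move=> d; rewrite complG inE -dvdn_divisors ?exponent_gt0.
Qed.

Theorem theorem5p1 (gT : finGroupType) (G : {group gT}) (nilG : nilpotent G) :
  exponent_complete G /\ eta G = tau (exponent G).
Proof.
have complG := nilpotent_exponent_complete _ _ nilG.
by split; last exact: exponent_complete_eta.
Qed.
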